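(* If an optimal solution $\mathbf{X}^*$ to the convex problem $\min_{\mathbf{X}\in\mathcal{F}_{n,k}} f(\mathbf{X})$ satisfies, for some $\delta>0$, the eigen-gap assumption $\lambda_{n-k}(\nabla f(\mathbf{X}^* ))-\lambda_{n-k+1}(\nabla f(\mathbf{X}^* ))\ge\delta$, then $\mathbf{X}^*$ has rank $k$, i.e. $\mathbf{X}^*\in\mathcal{P}_{n,k}$, and it is the unique optimal solution to both the convex problem $\min_{\mathbf{X}\in\mathcal{F}_{n,k}} f(\mathbf{X})$ and the nonconvex problem $\min_{\mathbf{X}\in\mathcal{P}_{n,k}} f(\mathbf{X})$.
   Context: Let $1\le k<n$ be integers. $\mathbb{S}^n$ is the space of real symmetric $n\times n$ matrices with inner product $\langle \mathbf{A},\mathbf{B}\rangle=\mathrm{Tr}(\mathbf{A}\mathbf{B})$; $\|\cdot\|_F$ is the Frobenius norm; $\lambda_i(\mathbf{A})$ is the $i$-th largest eigenvalue of $\mathbf{A}\in\mathbb{S}^n$. $\mathcal{P}_{n,k}=\{\mathbf{Q}\mathbf{Q}^\top : \mathbf{Q}\in\mathbb{R}^{n\times k},\ \mathbf{Q}^\top\mathbf{Q}=\mathbf{I}\}$, and the Fantope is $\mathcal{F}_{n,k}=\mathrm{conv}(\mathcal{P}_{n,k})=\{\mathbf{X}\in\mathbb{S}^n : \mathbf{I}\succeq\mathbf{X}\succeq0,\ \mathrm{Tr}(\mathbf{X})=k\}$. $f:\mathbb{S}^n\to\mathbb{R}$ is convex, differentiable and $\beta$-smooth, $\beta>0$: $\|\nabla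 f(\mathbf{X})-\nabla f(\mathbf{Y})\|_F\le\beta\|\mathbf{X}-\mathbf{Y}\|_F$ for all $\mathbf{X},\mathbf{Y}$. *)

(* Defs.v *)
From HB Require Import structures.
From mathcomp Require Import all_boot all_order all_algebra.
From mathcomp Require Import sesquilinear spectral complex.
From mathcomp Require Import ring.
From mathcomp Require Import all_classical all_reals all_analysis.

Set Implicit Arguments.
Unset Strict Implicit.
Unset Printing Implicit Defensive.

Import Order.TTheory GRing.Theory Num.Theory.
Import numFieldNormedType.Exports.

Local Open Scope classical_set_scope.
Local Open Scope ring_scope.

(* The space of real symmetric matrices is a subtype of the square matrices. It
   is made a normed module for the Frobenius norm, so that [differentiable] and
   ['d f X] below are taken inside that space (and not in ['M[R]_n], which
   carries the sup norm and where symmetric directions form a proper subspace). *)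
Section SymmetricMatrices.
Variables (R : realType) (n : nat).

Definition symm_pred : pred 'M[R]_n := fun A => A^T == A.

Record symmx := Symmx { symmx_val :> 'M[R]_n; _ : symm_pred symmx_val }.

HB.instance Definition _ := [isSub for symmx_val].
HB.instance Definition _ := [Choice of symmx by <:].

Let symm_closed : subsemimod_closed symm_pred.
Proof.
split; [split|] => [|A B /eqP hA /eqP hB|c A /eqP hA].
- by rewrite /in_mem /= /symm_pred trmx0.
- by rewrite /in_mem /= /symm_pred linearD /= hA hB.
- by rewrite /in_mem /= /symm_pred linearZ /= hA.
Qed.

HB.instance Definition _ :=
  GRing.SubChoice_isSubLmodule.Build R 'M[R]_n symm_pred symmx symm_closed.

Lemma symmxE (A : symmx) : A^T = A :> 'M[R]_n.
Proof. by case: A => A /= /eqP. Qed.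

Definition frob_dot (A B : symmx) : R := \tr (A *m B).

Definition frob_norm (A : symmx) : R :=
  Num.sqrt (\sum_i \sum_j (A i j) ^+ 2).

Lemma frob_dotE A B : frob_dot A B = \sum_i \sum_j A i j * B i j.
Proof.
apply: eq_bigr => i _; rewrite mxE; apply: eq_bigr => j _.
by rewrite -[in B j i](symmxE B) mxE.
Qed.

Lemma frob_normE A : frob_norm A = Num.sqrt (frob_dot A A).
Proof. by rewrite frob_dotE.
Qed.

Let dotC A B : frob_dot A B = frob_dot B A.
Proof. exact: mxtrace_mulC. Qed.

Let dotDl A B C : frob_dot (A + B) C = frob_dot A C + frob_dot B C.
Proof. by rewrite /frob_dot mulmxDl mxtraceD. Qed.

Let dotZl c A B : frob_dot (c *: A) B = c * frob_dot A B.
Proof. by rewrite /frob_dot -scalemxAl mxtraceZ. Qed.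

Let dot_ge0 A : 0 <= frob_dot A A.
Proof.
rewrite frob_dotE; apply: sumr_ge0 => i _; apply: sumr_ge0 => j _.
by rewrite -expr2 sqr_ge0.
Qed.

Let dot_eq0 A : frob_dot A A = 0 -> A = 0.
Proof.
rewrite frob_dotE => /eqP; rewrite psumr_eq0 => [/allP A0|i _]; last first.
  by apply: sumr_ge0 => j _; rewrite -expr2 sqr_ge0.
apply/val_inj/matrixP => i j; rewrite [RHS]mxE.
have /eqP := A0 i (mem_index_enum i).
move=> /eqP; rewrite psumr_eq0 => [/allP /(_ j (mem_index_enum j))|k _].
  by rewrite -expr2 sqrf_eq0 => /eqP.
by rewrite -expr2 sqr_ge0.
Qed.

Let cauchy_schwarz A B : frob_dot A B <= frob_norm A * frob_norm B.
Proof.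
rewrite !frob_normE.
set a := frob_dot A A; set b := frob_dot B B; set c := frob_dot A B.
have [b0|bn0] := eqVneq b 0.
  by rewrite /c (dot_eq0 b0) /frob_dot mulmx0 mxtrace0 mulr_ge0 ?sqrtr_ge0.
have b_gt0 : 0 < b by rewrite lt_def bn0 dot_ge0.
have : 0 <= frob_dot (b *: A + (- c) *: B) (b *: A + (- c) *: B) by [].
rewrite dotDl !dotZl ![frob_dot _ (_ + _)]dotC !dotDl !dotZl.
rewrite [frob_dot B A]dotC -/a -/b -/c.
rewrite (_ : _ + _ = b * (a * b - c ^+ 2)); last by ring.
rewrite pmulr_rge0 // subr_ge0 => cab.
rewrite -sqrtrM ?dot_ge0//; apply: (le_trans (ler_norm _)).
by rewrite -sqrtr_sqr ler_wsqrtr.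
Qed.

Let ler_frobD A B : frob_norm (A + B) <= frob_norm A + frob_norm B.
Proof.
have nn C : 0 <= frob_norm C by rewrite sqrtr_ge0.
have n2 C : frob_norm C ^+ 2 = frob_dot C C by rewrite frob_normE sqr_sqrtr.
rewrite -(@ler_pXn2r _ 2) ?nnegrE ?addr_ge0// sqrrD !n2.
rewrite dotDl ![frob_dot _ (_ + _)]dotC !dotDl [frob_dot B A]dotC.
by rewrite addrA lerD2r -addrA lerD2l -mulr2n lerMn2r cauchy_schwarz.
Qed.

Let frobZ c A : frob_norm (c *: A) = `|c| * frob_norm A.
Proof.
by rewrite !frob_normE dotZl dotC dotZl mulrA -expr2 sqrtrM ?sqr_ge0// sqrtr_sqr.
Qed.

Let frob0_eq0 A : frob_norm A = 0 -> A = 0.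
Proof.
rewrite frob_normE => /eqP; rewrite sqrtr_eq0 => A0.
by apply: dot_eq0; apply/eqP; rewrite eq_le A0 dot_ge0.
Qed.

HB.instance Definition _ :=
  @Lmodule_isNormed.Build R symmx frob_norm ler_frobD frobZ frob0_eq0.

Lemma symm_normE (A : symmx) : `|A| = frob_norm A.
Proof. by []. Qed.

Let symE_subproof i j :
  symm_pred (2^-1 *: (delta_mx i j + delta_mx j i) : 'M[R]_n).
Proof.
by apply/eqP; rewrite linearZ /= linearD /= !trmx_delta addrC.
Qed.
Let symE i j : symmx := Symmx (symE_subproof i j).

Let symm_sumE (I : Type) (r : seq I) (F : I -> symmx) :
  symmx_val (\sum_(i <- r) F i) = \sum_(i <- r) symmx_val (F i).
Proof. exact: (big_morph symmx_val). Qed.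

(* The gradient is the Riesz representative of the differential for the inner
   product [frob_dot]; [gradP] shows that it always exists. *)
Definition grad (f : symmx -> R) (X : symmx) : symmx :=
  xget 0 [set G | forall H, 'd f X H = frob_dot G H].

Lemma gradP (f : symmx -> R) (X H : symmx) :
  'd f X H = frob_dot (grad f X) H.
Proof.
move: H; apply: (@xgetPex _ (0 : symmx) [set G | forall H, 'd f X H = frob_dot G H]).
have sG : symm_pred (\matrix_(i, j) 'd f X (symE i j)).
  apply/eqP/matrixP => i j; rewrite !mxE; congr ('d f X _).
  by apply/val_inj; rewrite /= addrC.
exists (Symmx sG) => H /=; rewrite frob_dotE /=.
have {1}-> : H = \sum_i \sum_j H i j *: symE i j.
  apply/val_inj; rewrite /= symm_sumE.
  under eq_bigr do rewrite symm_sumE /=.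
  under eq_bigr do under eq_bigr do rewrite scalerA mulrC -scalerA scalerDr.
  under eq_bigr do rewrite -scaler_sumr big_split/=.
  rewrite -scaler_sumr big_split /=.
  rewrite -matrix_sum_delta [X in _ + X]exchange_big /=.
  rewrite [X in _ + X](_ : _ = symmx_val H); last first.
    rewrite [RHS]matrix_sum_delta; apply: eq_bigr => i _.
    by apply: eq_bigr => j _; rewrite -[in H j i](symmxE H) mxE.
  by rewrite -mulr2n -(scaler_nat 2 (symmx_val H)) scalerA mulVf ?scale1r//.
rewrite (raddf_sum ('d f X)) /=; apply: eq_bigr => i _.
rewrite (raddf_sum ('d f X)) /=; apply: eq_bigr => j _.
by rewrite linearZ /= mxE mulrC.
Qed.

End SymmetricMatrices.

Section Eigenvalues.
Variables (R : realType) (n : nat).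

(* All eigenvalues, repeated according to multiplicity, in decreasing order;
   [eigenvaluesP] below shows that the default value is never used. *)
Definition eigenvalues (A : symmx R n) : seq R :=
  xget [::] [set s | sorted >=%R s /\ char_poly A = \prod_(x <- s) ('X - x%:P)].

Let char_poly_conj (K : fieldType) (P B : 'M[K]_n) :
  P \in unitmx -> char_poly (invmx P *m B *m P) = char_poly B.
Proof.
move=> Pu; rewrite /char_poly.
have -> : char_poly_mx (invmx P *m B *m P) =
    map_mx polyC (invmx P) *m char_poly_mx B *m map_mx polyC P.
  rewrite /char_poly_mx mulmxBr mulmxBl !map_mxM; congr (_ - _).
  by rewrite scalar_mxC -mulmxA -map_mxM mulVmx // map_mx1 mulmx1.
rewrite !det_mulmx mulrAC -det_mulmx -map_mxM mulVmx // map_mx1 det1.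
by rewrite mul1r.
Qed.

Lemma eigenvaluesP (A : symmx R n) :
  sorted >=%R (eigenvalues A) /\
  char_poly A = \prod_(x <- eigenvalues A) ('X - x%:P).
Proof.
apply: (@xgetPex _ [::]
  [set s | sorted >=%R s /\ char_poly A = \prod_(x <- s) ('X - x%:P)]).
pose toC := real_complex R; pose AC := map_mx toC (symmx_val A).
have AC_herm : AC \is hermsymmx.
  apply/is_hermitianmxP; rewrite expr0 scale1r map_trmx -map_mx_comp.
  rewrite -{1}(symmxE A); apply/matrixP => i j; rewrite !mxE /=.
  exact/esym/conjc_real.
have /mxOverP spR := hermitian_spectral_diag_real AC_herm.
have /hermitian_normalmx /orthomx_spectralP AC_eq := AC_herm.
pose d i := complex.Re (spectral_diag AC 0 i).
have char_A : char_poly A = \prod_(i < n) ('X - (d i)%:P).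
  apply: (@map_poly_inj _ _ toC).
  rewrite map_char_poly -/AC AC_eq char_poly_conj ?spectral_unit //.
  rewrite char_poly_trig ?diag_mx_is_trig // rmorph_prod /=.
  apply: eq_bigr => i _; rewrite rmorphB /= map_polyX map_polyC /=.
  by rewrite mxE eqxx mulr1n RRe_real.
exists (sort >=%R [seq d i | i <- index_enum 'I_n]); split.
  by apply: sort_sorted => x y; exact: ge_total.
rewrite char_A.
rewrite -(big_map d xpredT (fun x => 'X - x%:P)).
by apply/esym/perm_big; rewrite perm_sort.
Qed.

Lemma size_eigenvalues (A : symmx R n) : size (eigenvalues A) = n.
Proof.
have [_ /(congr1 (size \o polyseq))] := eigenvaluesP A.
by rewrite /= size_char_poly size_prod_XsubC => -[].
Qed.

(* The [i]-th largest eigenvalue, counted from [i = 1]. *)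
Definition lambda (i : nat) (A : symmx R n) : R := (eigenvalues A)`_i.-1.

End Eigenvalues.

Definition argmin (R : realType) (T : Type) (f : T -> R) (D : set T) : set T :=
  [set x | D x /\ forall y, D y -> f x <= f y].

Definition convex_hull (R : realType) (V : lmodType R) (A : set V) : set V :=
  [set x | exists (m : nat) (a : 'I_m -> R) (p : 'I_m -> V),
    [/\ forall i, 0 <= a i, \sum_i a i = 1, forall i, A (p i)
      & x = \sum_i a i *: p i]].

Definition projections (R : realType) (n k : nat) : set (symmx R n) :=
  [set X | exists2 Q : 'M[R]_(n, k), Q^T *m Q = 1%:M & Q *m Q^T = X].

Definition fantope (R : realType) (n k : nat) : set (symmx R n) :=
  convex_hull (@projections R n k).

Arguments projections R n k : clear implicits.
Arguments fantope R n k : clear implicits.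

(* Main.v *)
(* Write G for the gradient at [Xs]. By the eigen-gap, the projection P onto
   the span of the eigenvectors for the k smallest eigenvalues of G satisfies
   <G, p - P> >= (delta / 2) |p - P|^2 for every rank-k projection p; averaging,
   P is the only Y in the fantope with <G, Y - P> <= 0. First-order optimality
   of [Xs] gives <G, Xs - P> <= 0, hence Xs = P; for any other minimiser Y,
   convexity gives <G, Y - Xs> <= f Y - f Xs <= 0, hence Y = P too. *)
Require Import Defs.
From mathcomp Require Import all_boot all_order all_algebra.
From mathcomp Require Import ring lra.
From mathcomp Require Import all_classical all_reals all_analysis.

Set Implicit Arguments.
Unset Strict Implicit.
Unset Printing Implicit Defensive.

Import Order.TTheory GRing.Theory Num.Theory.
Import numFieldNormedType.Exports.

Local Open Scope classical_set_scope.
Local Open Scope ring_scope.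

(** * Orthogonal diagonalisation of real symmetric matrices *)

Lemma char_poly_conj (K : fieldType) n (P B : 'M[K]_n) :
  P \in unitmx -> char_poly (invmx P *m B *m P) = char_poly B.
Proof.
move=> Pu; rewrite /char_poly.
have -> : char_poly_mx (invmx P *m B *m P) =
    map_mx polyC (invmx P) *m char_poly_mx B *m map_mx polyC P.
  rewrite /char_poly_mx mulmxBr mulmxBl !map_mxM; congr (_ - _).
  by rewrite scalar_mxC -mulmxA -map_mxM mulVmx // map_mx1 mulmx1.
rewrite !det_mulmx mulrAC -det_mulmx -map_mxM mulVmx // map_mx1 det1.
by rewrite mul1r.
Qed.

(* [H] is the Householder reflection exchanging the first basis vector and
   [u]; when they coincide, [2 / s] is the junk value 0 and [H] is 1. *)
Lemma unit_row_reflection (F : realFieldType) n (u : 'rV[F]_n.+1) :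
  u *m u^T = 1%:M ->
  exists H : 'M[F]_n.+1, [/\ H^T = H, H *m H = 1%:M & row 0 H = u].
Proof.
move=> u1; pose w := u - delta_mx 0 0.
pose s := (w *m w^T) 0 0; pose c := 2 / s.
have ww : w *m w^T = s%:M by rewrite [LHS]mx11_scalar.
(* Since [u] and the basis vector both have norm 1, [s = 2 - 2 * u 0 0]. *)
have s_w : s = - 2 * w 0 0.
  rewrite /s /w linearB /= trmx_delta mulmxBl !mulmxBr u1.
  rewrite mul_delta_mx -rowE -colE !mxE /=; ring.
(* This identity makes [H] an involution, and it survives the degenerate case [c = 0]. *)
have cs : c ^+ 2 * s = 2 * c.
  have [s0|s0] := eqVneq s 0; first by rewrite /c s0 invr0; ring.
  by rewrite /c; field.
exists (1%:M - c *: (w^T *m w)); split.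
- by rewrite linearB linearZ /= trmx1 trmx_mul trmxK.
- rewrite mulmxBr mulmx1 mulmxBl mul1mx -scalemxAl -scalemxAr.
  rewrite mulmxA -(mulmxA w^T w) ww mul_mx_scalar -scalemxAl !scalerA.
  have -> : c * (c * s) = c + c by rewrite mulrA -expr2 cs; ring.
  by rewrite scalerDl opprB addrK subrK.
- rewrite linearB linearZ /= row_mul (_ : row 0 w^T = (w 0 0)%:M); last first.
    by rewrite [LHS]mx11_scalar !mxE.
  rewrite mul_scalar_mx scalerA row1.
  (* If [s = 0], this sum of squares forces [w = 0]; otherwise [c * w 0 0 = -1] and the first row is
     [delta_mx 0 0 + w]. *)
  have [s0|s0] := eqVneq s 0.
    have w00 : w 0 0 = 0.
      apply/eqP; move: s_w => /eqP.
      by rewrite s0 eq_sym mulf_eq0 oppr_eq0 pnatr_eq0.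
    have /eqP : \sum_j (w 0 j) ^+ 2 = 0.
      by rewrite -[RHS]s0 [RHS]mxE; apply: eq_bigr => j _;
        rewrite [w^T _ _]mxE expr2.
    rewrite psumr_eq0 => [/allP w0|j _]; last exact: sqr_ge0.
    rewrite w00 mulr0 scale0r subr0; apply/rowP => j.
    apply/esym/eqP; rewrite -subr_eq0 -sqrf_eq0.
    by have := w0 j (mem_index_enum j); rewrite !mxE.
  have -> : c * w 0 0 = -1.
    by rewrite /c s_w; field; move: s0; rewrite s_w mulf_eq0 oppr_eq0 pnatr_eq0.
  by rewrite scaleN1r opprK addrC subrK.
Qed.

(** By [eigenvaluesP] the characteristic polynomial splits over the reals. It has [n.+1] roots, so
    the entry at index 0 is a genuine root and not a default value; its eigenvector is then
    normalised. *)
Lemma symmetric_unit_eigenvector (R : realType) n (A : 'M[R]_n.+1) :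
  A^T = A -> exists a (u : 'rV[R]_n.+1), u *m u^T = 1%:M /\ u *m A = a *: u.
Proof.
move=> /eqP sA; pose AS := Symmx sA.
have [_ cA] := eigenvaluesP AS.
have size_e := size_eigenvalues AS.
have /eigenvalueP[v vA v0] : eigenvalue A (eigenvalues AS)`_0.
  rewrite eigenvalue_root_char [char_poly A]cA root_prod_XsubC.
  by rewrite mem_nth ?size_e.
pose s := (v *m v^T) 0 0.
have vv : v *m v^T = s%:M by rewrite [LHS]mx11_scalar.
have s_gt0 : 0 < s.
  have sE : s = \sum_j (v 0 j) ^+ 2.
    by rewrite /s mxE; apply: eq_bigr => j _; rewrite mxE expr2.
  rewrite lt_def sE sumr_ge0 ?andbT => [|j _]; last exact: sqr_ge0.
  apply: contra v0; rewrite psumr_eq0 => [/allP v0|j _]; last exact: sqr_ge0.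
  apply/eqP/rowP => j; apply/eqP; rewrite mxE -sqrf_eq0.
  exact: v0 (mem_index_enum j).
exists (eigenvalues AS)`_0, ((Num.sqrt s)^-1 *: v); split.
  rewrite linearZ /= -scalemxAl -scalemxAr scalerA vv -expr2 exprVn.
  by rewrite sqr_sqrtr ?ltW// scale_scalar_mx mulVf// gt_eqF.
by rewrite -scalemxAl vA !scalerA mulrC.
Qed.

(** Deflation: conjugating by a reflection that sends the first basis vector to a unit eigenvector
    clears the rest of the first row, and by symmetry of the first column. Induction handles the
    remaining block. *)
Lemma symmetric_orthogonal_diag (R : realType) n (A : 'M[R]_n) :
  A^T = A ->
  exists (U : 'M[R]_n) (d : 'rV[R]_n),
    U *m U^T = 1%:M /\ A = U^T *m diag_mx d *m U.
Proof.
elim: n A => [|n IHn] A sA.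
  by exists 1%:M, 0; split; [rewrite trmx1 mulmx1|rewrite !flatmx0].
have [a [u [u1 uA]]] := symmetric_unit_eigenvector sA.
have [H [sH HH rowH]] := unit_row_reflection u1.
have [B BE] : exists B : 'M[R]_(1 + n), B = H *m A *m H by eexists.
have sB : B^T = B by rewrite BE !trmx_mul sH sA mulmxA.
have rowB : row 0 B = a *: delta_mx 0 0.
  by rewrite BE !row_mul rowH uA -scalemxAl -rowH -row_mul HH row1.
have ulB : ulsubmx B = a%:M.
  rewrite [LHS]mx11_scalar; congr scalar_mx.
  have /rowP/(_ 0) := rowB; rewrite !mxE !eqxx mulr1 => <-.
  by congr (B _ _); apply/val_inj.
have urB : ursubmx B = 0.
  apply/rowP => j; have /rowP/(_ (rshift 1 j)) := rowB.
  rewrite !mxE /= mulr0 => <-.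
  by congr (B _ _); apply/val_inj.
have dlB : dlsubmx B = 0 by rewrite -[B]sB -trmx_ursub urB trmx0.
have [|V [d [V1 dV]]] := IHn (drsubmx B); first by rewrite trmx_drsub sB.
pose W : 'M[R]_(1 + n) := block_mx 1%:M 0 0 V.
have W1 : W *m W^T = 1%:M.
  rewrite tr_block_mx mulmx_block !trmx0 !trmx1 !mulmx0 !mul0mx V1 mulmx1.
  by rewrite !addr0 !add0r -scalar_mx_block.
have dE : diag_mx (row_mx a%:M d : 'rV[R]_(1 + n)) =
    block_mx a%:M 0 0 (diag_mx d).
  rewrite diag_mx_row; congr block_mx.
  by apply/matrixP => i j; rewrite !mxE !ord1.
have WDW : W^T *m (block_mx a%:M 0 0 (diag_mx d) *m W) =
    block_mx a%:M 0 0 (V^T *m diag_mx d *m V).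
  rewrite tr_block_mx !mulmx_block !trmx0 !trmx1.
  rewrite !(mulmx0, mul0mx, mulmx1, mul1mx) !addr0 !add0r.
  by rewrite mulmx0 mulmxA.
exists (W *m H), (row_mx a%:M d : 'rV[R]_(1 + n)); split.
  by rewrite trmx_mul sH mulmxA -[W *m H *m H]mulmxA HH mulmx1.
have -> : A = H *m B *m H by rewrite BE !mulmxA HH mul1mx -mulmxA HH mulmx1.
rewrite trmx_mul sH !mulmxA; congr (_ *m _); rewrite -!mulmxA; congr (_ *m _).
by rewrite -[B]submxK ulB urB dlB dV dE WDW.
Qed.

(** The diagonal and [eigenvalues A] split the same characteristic polynomial, hence agree up to
    order. *)
Lemma symmx_eigenvalues_diag (R : realType) n (A : symmx R n) :
  exists (U : 'M[R]_n) (d : 'rV[R]_n),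
    [/\ U *m U^T = 1%:M, symmx_val A = U^T *m diag_mx d *m U
      & perm_eq [seq d 0 i | i <- index_enum 'I_n] (eigenvalues A)].
Proof.
have [U [d [U1 AE]]] := symmetric_orthogonal_diag (symmxE A).
exists U, d; split=> //.
have [Uu UV] : U \in unitmx /\ invmx U = U^T.
  by have [Uu _] := mulmx1_unit U1; split=> //; rewrite -[LHS]mulmx1 -U1 mulKmx.
apply: prod_XsubC_eq; have [_ <-] := eigenvaluesP A.
rewrite AE -UV char_poly_conj// char_poly_trig ?diag_mx_is_trig// big_map.
by apply: eq_bigr => i _; rewrite mxE eqxx mulr1n.
Qed.

(** * Rank-k projections and their growth away from the spectral one *)

Lemma projections_trace R n k (p : symmx R n) : projections R n k p ->
  symmx_val p *m p = p /\ \tr p = k%:R.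
Proof.
case=> Q Q1 <-; split; first by rewrite mulmxA -(mulmxA Q) Q1 mulmx1.
by rewrite mxtrace_mulC Q1 mxtrace1.
Qed.

Lemma projections_rank (R : realType) n k (p : symmx R n) :
  projections R n k p -> \rank p = k.
Proof.
case=> Q Q1 <-; apply/eqP; rewrite eqn_leq mulmx_max_rank /=.
(* The identity of size [k] equals [Q^T *m (Q *m Q^T) *m Q], so it factors through [p]. *)
rewrite -[leqLHS](mxrank1 R) -[1%:M](mulmx1 1%:M) -{2}Q1 -{1}Q1.
rewrite -mulmxA (mulmxA Q) (leq_trans (mxrankM_maxr _ _))//.
by rewrite mxrankM_maxl.
Qed.

Definition diag_set (R : pzRingType) n (S : {set 'I_n}) : 'M[R]_n :=
  diag_mx (\row_i (i \in S)%:R).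

Lemma tr_diag_setM (R : comPzRingType) n (S : {set 'I_n}) (A : 'M[R]_n) :
  \tr (diag_set R S *m A) = \sum_(i in S) A i i.
Proof.
rewrite /mxtrace [RHS]big_mkcond; apply: eq_bigr => i _.
by rewrite mul_diag_mx !mxE; case: ifP => _; rewrite ?mul1r ?mul0r.
Qed.

Lemma diag_set_projection (R : realType) n (U : 'M[R]_n) (S : {set 'I_n}) :
  U *m U^T = 1%:M ->
  exists2 P : symmx R n, projections R n #|S| P
    & symmx_val P = U^T *m diag_set R S *m U.
Proof.
(* The columns of [Q] are the rows of [U] indexed by [S], which are orthonormal. *)
move=> U1; pose Q := colsub (@enum_val _ (mem S)) U^T.
have sP : symm_pred (Q *m Q^T) by apply/eqP; rewrite trmx_mul trmxK.
exists (Symmx sP); first (exists Q => //); last first.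
  apply/matrixP => i j; rewrite /= mul_mx_diag !mxE.
  rewrite (eq_bigr (fun l => U (enum_val l) i * U (enum_val l) j)); last first.
    by move=> l _; rewrite !mxE.
  rewrite -(@big_enum_val _ _ _ _ (mem S) (fun l => U l i * U l j)) /=.
  rewrite big_mkcond; apply: eq_bigr => l _; rewrite !mxE.
  by case: ifP => _; rewrite ?mulr1 ?mulr0 ?mul0r.
apply/matrixP => i j; rewrite !mxE.
have /matrixP/(_ (enum_val i) (enum_val j)) := U1.
rewrite !mxE (inj_eq enum_val_inj) => <-.
by apply: eq_bigr => l _; rewrite !mxE.
Qed.

(* In the eigenbasis of [G], with [Z] the matrix of [p]: since [\tr Z = #|S|],
   [<G, p - P> = \sum_i (d i - mu) * (Z i i - (i \in S))], every summand is
   nonnegative, and [|p - P|^2 = 2 * \sum_(i notin S) Z i i]. *)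
Lemma spectral_gap_growth (R : realType) n (G P p : symmx R n) (U : 'M[R]_n)
    (d : 'rV[R]_n) (S : {set 'I_n}) (mu delta : R) :
  U *m U^T = 1%:M -> symmx_val G = U^T *m diag_mx d *m U ->
  symmx_val P = U^T *m diag_set R S *m U ->
  (forall i, i \in S -> d 0 i <= mu) ->
  (forall i, i \notin S -> mu + delta <= d 0 i) ->
  projections R n #|S| p ->
  delta / 2 * frob_dot (p - P) (p - P) <= frob_dot G (p - P).
Proof.
move=> U1 GE PE dS dNS /projections_trace[pp trp].
have U1' : U^T *m U = 1%:M by apply: mulmx1C.
pose Z := U *m p *m U^T; pose E := diag_set R S.
have pE : symmx_val p = U^T *m Z *m U.
  by rewrite /Z !mulmxA U1' mul1mx -mulmxA U1' mulmx1.
have ZZ : Z *m Z = Z.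
  by rewrite /Z !mulmxA -(mulmxA _ U^T U) U1' mulmx1 -(mulmxA U) pp.
have ZT : Z^T = Z by rewrite /Z !trmx_mul trmxK symmxE mulmxA.
have trZ : \tr Z = #|S|%:R.
  by rewrite /Z mxtrace_mulC mulmxA U1' mul1mx.
have trconj A B : \tr ((U^T *m A *m U) *m (U^T *m B *m U)) = \tr (A *m B).
  rewrite !mulmxA -(mulmxA _ U U^T) U1 mulmx1 mxtrace_mulC !mulmxA.
  by rewrite U1 mul1mx.
have diffE : symmx_val (p - P) = U^T *m (Z - E) *m U.
  by rewrite mulmxBr mulmxBl -pE -PE.
have trE : \tr E = #|S|%:R.
  rewrite /E -[diag_set _ _]mulmx1 tr_diag_setM.
  under eq_bigr do rewrite mxE eqxx.
  by rewrite sumr_const.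
have EE : E *m E = E.
  rewrite /E /diag_set mulmx_diag; congr diag_mx; apply/rowP => i.
  by rewrite !mxE -natrM mulnb andbb.
(* A symmetric idempotent has [Z i i] equal to the squared norm of its row [i], hence at least
   [Z i i ^+ 2]. *)
have Z01 i : 0 <= Z i i <= 1.
  have Zii : Z i i = \sum_j Z i j ^+ 2.
    rewrite -{1}ZZ mxE; apply: eq_bigr => j _.
    by rewrite -[in Z j i]ZT [Z^T _ _]mxE expr2.
  have Zii2 : Z i i ^+ 2 <= Z i i.
    rewrite [leRHS]Zii (bigD1 i) //= lerDl.
    by apply: sumr_ge0 => j _; apply: sqr_ge0.
  by apply/andP; split; nra.
have ->: frob_dot (p - P) (p - P) = 2 * \sum_(i | i \notin S) Z i i.
  have trEZ : \tr (E *m Z) = \sum_(i in S) Z i i by rewrite tr_diag_setM.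
  have trZS : \tr Z = \sum_(i in S) Z i i + \sum_(i | i \notin S) Z i i.
    by rewrite /mxtrace (bigID (mem S)).
  rewrite /frob_dot diffE trconj mulmxBl !mulmxBr ZZ EE !raddfB /=.
  rewrite (mxtrace_mulC Z) trEZ trE -trZ trZS; ring.
have -> : frob_dot G (p - P) =
    \sum_i (d 0 i - mu) * (Z i i - (i \in S)%:R).
  rewrite /frob_dot GE diffE trconj.
  (* Equal traces allow shifting every eigenvalue by [mu] for free. *)
  have tr0 : \sum_i (Z i i - (i \in S)%:R) = 0.
    rewrite sumrB -/(\tr Z) trZ -trE /E /diag_set mxtrace_diag.
    by under [X in X - _]eq_bigr do rewrite mxE; rewrite subrr.
  rewrite -[LHS]subr0 -[in X in _ - X](mulr0 mu) -[in X in _ - X]tr0.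
  rewrite mulr_sumr -sumrB.
  apply: eq_bigr => i _; rewrite mul_diag_mx mxE.
  have -> : (Z - E) i i = Z i i - (i \in S)%:R.
    by rewrite [LHS]mxE; congr (_ + _); rewrite !mxE eqxx.
  ring.
rewrite mulrA divfK ?pnatr_eq0// mulr_sumr big_mkcond /=.
(* For [i] in [S] both factors on the right are nonpositive; outside [S] the gap bounds [d 0 i - mu]
   below by [delta]. *)
apply: ler_sum => i _; have /andP[Z0 Z1] := Z01 i.
case: (boolP (i \in S)) => iS /=.
  by have := dS _ iS; nra.
by rewrite subr0 ler_wpM2r//; have := dNS _ iS; lra.
Qed.

(** * From projections to the Fantope by averaging *)

Lemma frob_dotDr (R : realType) n (A B C : symmx R n) :
  frob_dot A (B + C) = frob_dot A B + frob_dot A C.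
Proof. by rewrite /frob_dot mulmxDr mxtraceD. Qed.

Lemma frob_dotZr (R : realType) n (A B : symmx R n) c :
  frob_dot A (c *: B) = c * frob_dot A B.
Proof. by rewrite /frob_dot -scalemxAr mxtraceZ. Qed.

Lemma frob_dot_sumr (R : realType) n (A : symmx R n) m (B : 'I_m -> symmx R n) :
  frob_dot A (\sum_i B i) = \sum_i frob_dot A (B i).
Proof.
apply: (big_morph (frob_dot A)); first exact: frob_dotDr.
by rewrite /frob_dot mulmx0 mxtrace0.
Qed.

Lemma frob_dot_sqr (R : realType) n (A : symmx R n) :
  frob_dot A A = `|A| ^+ 2.
Proof.
rewrite symm_normE frob_normE sqr_sqrtr // frob_dotE.
by do 2![apply: sumr_ge0 => ? _]; rewrite -expr2 sqr_ge0.
Qed.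

(** Averaging the growth bound over a convex combination gives a sum of nonnegative terms that is at
    most 0. Every term vanishes, so each projection of nonzero weight equals [P]. *)
Lemma fantope_growth_min (R : realType) n k (G P Y : symmx R n) (c : R) :
  0 < c ->
  (forall p, projections R n k p ->
     c * frob_dot (p - P) (p - P) <= frob_dot G (p - P)) ->
  fantope R n k Y -> frob_dot G (Y - P) <= 0 -> Y = P.
Proof.
move=> c0 growth [m [a [p [a0 a1 pP YE]]]].
have -> : Y - P = \sum_i a i *: (p i - P).
  under eq_bigr do rewrite scalerBr.
  by rewrite sumrB -scaler_suml a1 scale1r -YE.
rewrite frob_dot_sumr => le0.
have growth_i i : c * (a i * `|p i - P| ^+ 2) <= frob_dot G (a i *: (p i - P)).
  by rewrite frob_dotZr mulrCA ler_wpM2l// -frob_dot_sqr growth.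
have nn i : 0 <= c * (a i * `|p i - P| ^+ 2).
  by apply: mulr_ge0; [exact: ltW | apply: mulr_ge0 => //; exact: sqr_ge0].
have /eqP : \sum_i c * (a i * `|p i - P| ^+ 2) = 0.
  apply/eqP; rewrite eq_le sumr_ge0 ?andbT//.
  by apply: le_trans le0; apply: ler_sum.
rewrite psumr_eq0// => /allP eq0.
apply/eqP; rewrite -subr_eq0; apply/eqP.
rewrite YE -[P in _ - P]scale1r -a1 scaler_suml -sumrB big1// => i _.
have := eq0 i (mem_index_enum i).
rewrite mulf_eq0 (gt_eqF c0) /= mulf_eq0 sqrf_eq0 normr_eq0 -scalerBr.
by case/orP => /eqP ->; rewrite ?scale0r ?scaler0.
Qed.

Lemma projections_fantope (R : realType) n k (p : symmx R n) :
  projections R n k p -> fantope R n k p.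
Proof.
move=> pP; exists 1%N, (fun=> 1), (fun=> p); split=> //.
- by rewrite big_ord1.
- by rewrite big_ord1 scale1r.
Qed.

(** * The eigen-gap in the sorted list of eigenvalues *)

(** [lambda] counts from 1 and the list from 0, so the gap lies between indices [n - k - 1] and
    [n - k]; monotonicity extends it to all indices. *)
Lemma lambda_gap (R : realType) n k (A : symmx R n) (delta : R) :
  (1 <= k)%N -> (k < n)%N ->
  delta <= lambda (n - k) A - lambda (n - k + 1) A ->
  forall j, (j < n)%N ->
  if (j < n - k)%N then lambda (n - k + 1) A + delta <= (eigenvalues A)`_j
  else (eigenvalues A)`_j <= lambda (n - k + 1) A.
Proof.
move=> k1 kn gap j jn; have [se _] := eigenvaluesP A.
have mono i l : (i <= l)%N -> (l < n)%N ->
    (eigenvalues A)`_l <= (eigenvalues A)`_i.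
  move=> il ln.
  have := sorted_leq_nth (@ge_trans _ _) (@lexx _ _) 0 se.
  apply; rewrite ?inE ?size_eigenvalues//; exact: leq_ltn_trans ln.
case: ltnP => jk.
  rewrite (le_trans _ (mono j (n - k).-1 _ _))//.
  - by move: gap; rewrite /lambda; lra.
  - by rewrite -ltnS prednK ?subn_gt0.
  - by rewrite prednK ?subn_gt0// leq_subr.
by rewrite /lambda addn1 /= mono.
Qed.

(** The order of [d] is unknown, so [S] is cut out by a threshold. Counting is invariant under
    permutation, and in the sorted list exactly the last [k] entries pass, because [delta] is
    positive. *)
Lemma lambda_gap_card (R : realType) n k (A : symmx R n) (delta : R)
    (d : 'rV[R]_n) :
  (1 <= k)%N -> (k < n)%N -> 0 < delta ->
  delta <= lambda (n - k) A - lambda (n - k + 1) A ->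
  perm_eq [seq d 0 i | i <- index_enum 'I_n] (eigenvalues A) ->
  let S := [set i | d 0 i <= lambda (n - k + 1) A]%SET in
  #|S| = k /\
  forall i, i \notin S -> lambda (n - k + 1) A + delta <= d 0 i.
Proof.
move=> k1 kn delta0 gap pe S; have gapj := lambda_gap k1 kn gap.
set mu := lambda _ A in S gapj *; set e := eigenvalues A in pe gapj.
have size_e : size e = n by rewrite size_eigenvalues.
split=> [|i].
  have -> : #|S| = count (<= mu) e.
    rewrite -(seq.permP pe) count_map -sum1_card -sum1_count.
    by apply: eq_bigl => i; rewrite /= inE.
  rewrite -(cat_take_drop (n - k) e) count_cat.
  rewrite (eqP (_ : count _ (take _ _) == 0)%N).
    have : all (<= mu) (drop (n - k) e).
      apply/(all_nthP 0) => j; rewrite size_drop size_e nth_drop => jk /=.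
      have jn : (n - k + j < n)%N by rewrite -ltn_subRL.
      by have := gapj _ jn; rewrite [(_ < n - k)%N]ltnNge leq_addr.
    by rewrite all_count => /eqP ->; rewrite size_drop size_e subKn// ltnW.
  rewrite -leqn0 leqNgt -has_count -all_predC; apply/(all_nthP 0) => j.
  rewrite size_take size_e ltn_subrL k1 (leq_trans _ kn)//= => jk.
  have := gapj j (leq_trans jk (leq_subr _ _)).
  by rewrite nth_take// jk -ltNge; apply: lt_le_trans; rewrite ltrDl.
rewrite inE -ltNge => mud.
have : d 0 i \in e.
  by rewrite -(perm_mem pe); apply/mapP; exists i; rewrite ?mem_index_enum.
move=> /(nthP 0)[j]; rewrite size_e => jn ej; move: mud; rewrite -ej.
by have := gapj j jn; case: ifP => // _ /le_lt_trans h /h; rewrite ltxx.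
Qed.

(** * Segments in the Fantope and one-sided derivatives *)

(** The two families of projections are concatenated, with weights scaled by [1 - t] and [t]. The
    point is written as it occurs in a difference quotient at [X]. *)
Lemma fantope_convex (R : realType) n k (X Y : symmx R n) (t : R) :
  fantope R n k X -> fantope R n k Y -> 0 <= t <= 1 ->
  fantope R n k (t *: (Y - X) + X).
Proof.
move=> [m [a [p [a0 a1 pP ->]]]] [l [b [q [b0 b1 qP ->]]]] /andP[t0 t1].
pose w (i : 'I_(m + l)) :=
  match fintype.split i with inl j => (1 - t) * a j | inr j => t * b j end.
pose r (i : 'I_(m + l)) :=
  match fintype.split i with inl j => p j | inr j => q j end.
have splitl j : fintype.split (lshift l j : 'I_(m + l)) = inl j :=
  unsplitK (inl j).
have splitr j : fintype.split (rshift m j : 'I_(m + l)) = inr j :=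
  unsplitK (inr j).
exists (m + l)%N, w, r; split=> [i||i|].
- by rewrite /w; case: fintype.split => j; rewrite mulr_ge0 ?subr_ge0.
- rewrite big_split_ord /=.
  under eq_bigr do rewrite /w splitl.
  under [X in _ + X]eq_bigr do rewrite /w splitr.
  by rewrite -!mulr_sumr a1 b1 !mulr1 subrK.
- by rewrite /r; case: fintype.split.
- rewrite big_split_ord /=.
  under [in RHS]eq_bigr do rewrite /w /r splitl -scalerA.
  under [X in _ = _ + X]eq_bigr do rewrite /w /r splitr -scalerA.
  rewrite -!scaler_sumr scalerBl scale1r scalerBr.
  by rewrite [RHS]addrC [in RHS](addrC _ (- _)) addrA.
Qed.

Lemma convex_function_le (R : realType) (V : lmodType R) (f : V -> R)
    (X Y : V) (t : R) :
  convex_function [set: V] f -> 0 <= t <= 1 ->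
  f (t *: (Y - X) + X) <= t * f Y + (1 - t) * f X.
Proof.
move=> cf /andP[t0 t1].
have := cf (Itv01 t0 t1) Y X; rewrite !in_setE => /(_ I I).
rewrite (_ : t *: (Y - X) + X =
    conv (Itv01 t0 t1) (Y : convex_lmodType V) X); last first.
  rewrite [RHS]/(t *: Y + (1 - t) *: X) scalerBl scale1r scalerBr.
  by rewrite -!addrA [- _ + _]addrC.
by [].
Qed.

(** The derivative along [h] is also the limit from the right, so a bound for [t] in (0, 1]
    suffices: this is the range where the segment stays feasible. *)
Lemma diff_ge_right (R : realType) (V : normedModType R) (f : V -> R)
    (X h : V) (c : R) :
  differentiable f X ->
  (forall t, 0 < t -> t <= 1 -> t * c <= f (t *: h + X) - f X) ->
  c <= 'd f X h.
Proof.
move=> df fc; rewrite -deriveE//.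
have /cvg_dnbhs_at_right cvf : derivable f X h by exact: diff_derivable.
rewrite /derive -(cvg_lim _ cvf)//.
apply: limr_ge; first by apply/cvg_ex; eexists; exact: cvf.
near=> t.
have t0 : 0 < t by near: t; exact: nbhs_right_gt.
rewrite ler_pdivlMl// fc//.
by near: t; exact: nbhs_right_le.
Unshelve. all: by end_near.
Qed.

Lemma diff_le_right (R : realType) (V : normedModType R) (f : V -> R)
    (X h : V) (c : R) :
  differentiable f X ->
  (forall t, 0 < t -> t <= 1 -> f (t *: h + X) - f X <= t * c) ->
  'd f X h <= c.
Proof.
move=> df fc; rewrite -deriveE//.
have /cvg_dnbhs_at_right cvf : derivable f X h by exact: diff_derivable.
rewrite /derive -(cvg_lim _ cvf)//.
apply: limr_le; first by apply/cvg_ex; eexists; exact: cvf.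
near=> t.
have t0 : 0 < t by near: t; exact: nbhs_right_gt.
rewrite ler_pdivrMl// fc//.
by near: t; exact: nbhs_right_le.
Unshelve. all: by end_near.
Qed.

(** * Optimality and uniqueness *)

Theorem theorem1 (R : realType) (n k : nat) (hk : (1 <= k)%N) (hkn : (k < n)%N)
    (f : symmx R n -> R) (beta : R) (hbeta : 0 < beta)
    (f_convex : convex_function [set: symmx R n] f)
    (f_diff : forall X : symmx R n, differentiable f X)
    (f_smooth : forall X Y : symmx R n,
       frob_norm (grad f X - grad f Y) <= beta * frob_norm (X - Y))
    (Xs : symmx R n) (Xs_opt : argmin f (fantope R n k) Xs)
    (delta : R) (hdelta : 0 < delta)
    (gap : lambda (n - k) (grad f Xs) - lambda (n - k + 1) (grad f Xs)
             >= delta) :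
  [/\ \rank (symmx_val Xs) = k,
      projections R n k Xs,
      argmin f (fantope R n k) = [set Xs]
    & argmin f (projections R n k) = [set Xs]].
Proof.
have [XsF Xs_min] := Xs_opt.
have [U [d [U1 GE pe]]] := symmx_eigenvalues_diag (grad f Xs).
have [cardS dNS] := lambda_gap_card hk hkn hdelta gap pe.
set S := [set i | _]%SET in cardS dNS.
have [P PP PE] := diag_set_projection S U1.
have growth p : projections R n k p ->
    delta / 2 * frob_dot (p - P) (p - P) <= frob_dot (grad f Xs) (p - P).
  rewrite -cardS; apply: (spectral_gap_growth U1 GE PE _ dNS) => i.
  by rewrite inE.
rewrite cardS in PP.
have uniqP Y : fantope R n k Y -> frob_dot (grad f Xs) (Y - P) <= 0 -> Y = P.
  by apply: fantope_growth_min growth; rewrite divr_gt0.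
(* Along the segment from [Xs] to [P] the value of [f] never drops below [f Xs], so the derivative
   towards [P] is nonnegative. *)
have XsP : Xs = P.
  apply: uniqP => //; rewrite -opprB -scaleN1r frob_dotZr mulN1r oppr_le0.
  rewrite -gradP; apply: diff_ge_right => // t t0 t1.
  rewrite mulr0 subr_ge0; apply: Xs_min.
  by apply: fantope_convex => //; [exact: projections_fantope | rewrite ltW].
have uniq_opt Y : fantope R n k Y -> f Y <= f Xs -> Y = Xs.
  move=> YF fY; rewrite XsP; apply: uniqP => //; rewrite -XsP -gradP.
  (* By convexity [f] stays at most [f Xs] on the segment towards [Y]. *)
  apply: diff_le_right => // t t0 t1; rewrite mulr0 subr_le0.
  have t01 : 0 <= t <= 1 by rewrite ltW.
  by have := convex_function_le Xs Y f_convex t01; nra.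
have XsPr : projections R n k Xs by rewrite XsP.
split=> //; first exact: projections_rank XsPr.
  apply/seteqP; split=> [Y [YF Ymin]|Y ->//].
  by apply: uniq_opt => //; exact: Ymin.
(* As [Xs] is itself a projection, a minimiser over projections has value at most [f Xs], and it
   lies in the Fantope. *)
apply/seteqP; split=> [Y [YP Ymin]|Y ->].
  by apply: uniq_opt; [exact: projections_fantope | exact: Ymin].
by split=> // Y' /projections_fantope; exact: Xs_min.
Qed.
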